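(* Let $(X,\rho)$ be a metric space, let $A,B\subseteq X$, let $C$ be an arbitrary set, let $P\subseteq A\times B\times C^2$, let $(T_A,T_B,H_A,H_B,f_A,f_B)\in CEF_C^P(A,B)$ and let $(A,B)\in CD_X^P(f_A,f_B)$. Then the following hold. (1) If $(x_0,y_0,u_0,v_0)\in P$, $\{x_n\}_{n=0}^\infty$ and $\{u_n\}_{n=0}^\infty$ are the iterated sequences of $(T_A,H_A)$ with initial guess $(x_0,u_0)$, and $\{y_n\}_{n=0}^\infty$ and $\{v_n\}_{n=0}^\infty$ are the iterated sequences of $(T_B,H_B)$ with initial guess $(y_0,v_0)$, then there exists $\lim_{n\to\infty}x_n=\alpha\in A$, and $$\lim_{n\to\infty}\rho(y_n,\alpha)=\mathrm{dist}(A,B),\qquad \lim_{n\to\infty}f_A(u_n)=\inf_{c\in C}f_A(c),\qquad \lim_{n\to\infty}f_B(v_n)=\inf_{c\in C}f_B(c).$$ (2) If $(x_0,y_0,u_0,v_0)\in P$ and $(z_0,y_0,t_0,v_0)\in P$, $\{x_n\}_{n=0}^\infty$ and $\{u_n\}_{n=0}^\infty$ are the iterated sequences of $(T_A,H_A)$ with initial guess $(x_0,u_0)$, and $\{z_n\}_{n=0}^\infty$ and $\{t_n\}_{n=0}^\infty$ are the iterated sequences of $(T_A,H_A)$ with initial guess $(z_0,t_0)$, then $\lim_{n\to\infty}x_n=\lim_{n\to\infty}z_n\in A$. (3) If $(x_0,y_0,u_0,v_0)\in P$, $\{x_n\}_{n=0}^\infty$ and $\{u_n\}_{n=0}^\infty$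 are the iterated sequences of $(T_A,H_A)$ with initial guess $(x_0,u_0)$, $\alpha=\lim_{n\to\infty}x_n$, and $\{c_n\}_{n=0}^\infty\in IS_{f_A}^P(\alpha,y_0,v_0)$, then $\lim_{n\to\infty}T_A(\alpha,c_n)=\alpha$. (4) If $(x_0,y_0,u_0,v_0)\in P$, $\{x_n\}_{n=0}^\infty$ and $\{u_n\}_{n=0}^\infty$ are the iterated sequences of $(T_A,H_A)$ with initial guess $(x_0,u_0)$, and $\lim_{n\to\infty}x_n=\alpha$, then there is no $\beta\in A$ such that $\beta\neq\alpha$ and $\lim_{n\to\infty}T_A(\beta,c_n)=\beta$, where $\{c_n\}_{n=0}^\infty\in IS_{f_A}^P(\beta,y_0,v_0)$.
   Context: Notation: $\mathbb{N}=\{1,2,3,\dots\}$ is the set of natural numbers (not containing $0$), $\mathrm{dist}(A,B)=\inf_{a\in A,b\in B}\rho(a,b)$. Iterated sequences: for sets $A,C$, maps $T:A\times C\to A$, $H:A\times C\to C$ and $(x_0,u_0)\in A\times C$, the sequences $\{x_n\}_{n=0}^\infty$, $\{u_n\}_{n=0}^\infty$ defined by $x_{n+1}=T(x_n,u_n)$, $u_{n+1}=H(x_n,u_n)$ ($n\ge 0$) are called the iterated sequences of $(T,H)$ with initial guess $(x_0,u_0)$. Property $CD$: let $(X,\rho)$ be a metric space, $A,B\subseteq X$, $C$ an arbitrary set, $P\subseteq A\times B\times C^2$, $f_A,f_B:C\to\mathbb{R}$. We write $(A,B)\in CD_X^P(f_A,f_B)$ if for every two sequences $\{x_n\}_{n=1}^\infty\subseteq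 A$, $\{y_n\}_{n=1}^\infty\subseteq B$ such that (i) $\lim_{k\to\infty}\sup_{n\ge k,\,m\ge k}\rho(x_n,y_m)=\mathrm{dist}(A,B)$, and (ii) there exist $\{u_n\}_{n=1}^\infty\subseteq C$, $\{v_n\}_{n=1}^\infty\subseteq C$ with $(x_n,y_m,u_n,v_m)\in P$ for every $n,m\in\mathbb{N}$, $\lim_{n\to\infty}f_A(u_n)=\inf_{c\in C}f_A(c)$ and $\lim_{n\to\infty}f_B(v_n)=\inf_{c\in C}f_B(c)$, the sequence $\{x_n\}_{n=1}^\infty$ converges in $A$ (to a point of $A$). Contraction map set with an external factor: put $S_{f_A,f_B}^C(A,B)=\mathrm{dist}(A,B)+\inf_{c\in C}f_A(c)+\inf_{c\in C}f_B(c)$. For $T_A:A\times C\to A$, $H_A:A\times C\to C$, $T_B:B\times C\to B$, $H_B:B\times C\to C$, $f_A,f_B:C\to\mathbb{R}$ and $P\subseteq A\times B\times C^2$, we write $(T_A,T_B,H_A,H_B,f_A,f_B)\in CEF_C^P(A,B)$ if: (a) whenever $(x_0,y_0,u_0,v_0)\in P$, $\{x_n\}_{n=0}^\infty,\{u_n\}_{n=0}^\infty$ are the iterated sequences of $(T_A,H_A)$ with initial guess $(x_0,u_0)$, and $\{y_n\}_{n=0}^\infty,\{v_n\}_{n=0}^\infty$ are the iterated sequences of $(T_B,H_B)$ with initial guess $(y_0,v_0)$, then $(x_n,y_m,u_n,v_m)\in P$ for every $n,m\in\mathbb{N}$; (b) $\inf_{c\in C}f_A(c)\in\mathbb{R}$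 and $\inf_{c\in C}f_B(c)\in\mathbb{R}$; (c) there is $\lambda\in[0,1)$ such that for every $(x,y,u,v)\in P$, $$\rho(T_A(x,u),T_B(y,v))+f_A(H_A(x,u))+f_B(H_B(y,v))\le\lambda\big(\rho(x,y)+f_A(u)+f_B(v)\big)+(1-\lambda)S_{f_A,f_B}^C(A,B).$$ Infimum sequences: for $f:C\to\mathbb{R}$, $a\in A$, $y\in B$, $v\in C$, we write $\{c_n\}_{n=0}^\infty\in IS_f^P(a,y,v)$ if $\{c_n\}_{n=0}^\infty\subseteq C$, $\lim_{n\to\infty}f(c_n)=\inf_{c\in C}f(c)$, and $(a,y,c_n,v)\in P$ for every $n\in\mathbb{N}$.
   Formalization: In (3) and (4) it is additionally assumed that condition (a) of CEF holds for all n, m ≥ 0, so that (x_n,y_m,u_n,v_m) ∈ P also when n = 0 or m = 0; with n, m ≥ 1 only, (3) and (4) are false. *)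

(* Defs.v *)
From HB Require Import structures.
From mathcomp Require Import all_boot all_order all_algebra.
From mathcomp Require Import all_classical all_reals all_analysis.

Set Implicit Arguments.
Unset Strict Implicit.
Unset Printing Implicit Defensive.

Import Order.TTheory GRing.Theory Num.Theory.

Local Open Scope classical_set_scope.
Local Open Scope ring_scope.
Local Open Scope ereal_scope.

(* Throughout, A, B : set X are used as types through the coercion set_type,  *)
(* so that T : A -> C -> A is a map A x C -> A, and limits of points of A are *)
(* taken in X, after applying val. Infima and suprema are taken in \bar R, so *)
(* that they have their usual meaning also for empty or unbounded families.   *)

Definition set_dist (R : realType) (X : metricType R) (A B : set X) : \bar R :=
  ereal_inf [set (mdist a b)%:E | a in A & b in B].

Definition inf_val (R : realType) (C : Type) (f : C -> R) : \bar R :=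
  ereal_inf (range (EFin \o f)).

Definition iterated (A C : Type) (T : A -> C -> A) (H : A -> C -> C)
    (x0 : A) (u0 : C) (x : nat -> A) (u : nat -> C) : Prop :=
  [/\ x 0%N = x0, u 0%N = u0 &
      forall n, x n.+1 = T (x n) (u n) /\ u n.+1 = H (x n) (u n)].

(* The sequences of property CD are indexed by n >= 1: the values at 0 of     *)
(* x, y, u, v are unconstrained and play no role.                             *)
Definition CD (R : realType) (X : metricType R) (A B : set X) (C : Type)
    (P : set (A * B * C * C)) (fA fB : C -> R) : Prop :=
  forall (x : nat -> A) (y : nat -> B),
    ereal_sup [set (mdist (val (x n)) (val (y m)))%:E
                | n in [set n | (k <= n)%N] & m in [set m | (k <= m)%N]]
      @[k --> \oo] --> set_dist A B ->
    (exists u v : nat -> C,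
      [/\ forall n m, (0 < n)%N -> (0 < m)%N -> P (x n, y m, u n, v m),
          (fA (u n))%:E @[n --> \oo] --> inf_val fA &
          (fB (v n))%:E @[n --> \oo] --> inf_val fB]) ->
    exists a : A, val (x n) @[n --> \oo] --> val a.

Definition CEF_S (R : realType) (X : metricType R) (A B : set X) (C : Type)
    (fA fB : C -> R) : \bar R :=
  set_dist A B + inf_val fA + inf_val fB.

(* CEF uses k = 1, the pairs of indices in {1, 2, ...}. The case k = 0 also   *)
(* puts (x0, y_m, u0, v_m) and (x_n, y0, u_n, v0) in P. This is strictly      *)
(* stronger: A = B = R, C a point, fA = fB = 0, TA 0 = 1, TA x = x / 2 for    *)
(* x <> 0, TB y = y / 2 and P = {0, 1} x {10} U {2^-i} x {10 * 2^-j | j > 0}  *)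
(* satisfy CD and CEF (lambda = 1/2), while the orbit of 1 under TA tends to  *)
(* 0 and TA 0 = 1 is at distance 1 from 0.                                    *)
Definition orbits_in (R : realType) (X : metricType R) (A B : set X) (C : Type)
    (k : nat) (P : set (A * B * C * C))
    (TA : A -> C -> A) (HA : A -> C -> C)
    (TB : B -> C -> B) (HB : B -> C -> C) : Prop :=
  forall x0 y0 u0 v0 x y u v, P (x0, y0, u0, v0) ->
    iterated TA HA x0 u0 x u -> iterated TB HB y0 v0 y v ->
    forall n m, (k <= n)%N -> (k <= m)%N -> P (x n, y m, u n, v m).

Definition CEF (R : realType) (X : metricType R) (A B : set X) (C : Type)
    (P : set (A * B * C * C))
    (TA : A -> C -> A) (TB : B -> C -> B)
    (HA : A -> C -> C) (HB : B -> C -> C) (fA fB : C -> R) : Prop :=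
  [/\ orbits_in 1 P TA HA TB HB,
      inf_val fA \is a fin_num,
      inf_val fB \is a fin_num &
      exists lambda : R, [/\ (0 <= lambda)%R, (lambda < 1)%R &
        forall x y u v, P (x, y, u, v) ->
          (mdist (val (TA x u)) (val (TB y v))
             + fA (HA x u) + fB (HB y v))%:E
          <= (lambda * (mdist (val x) (val y) + fA u + fB v))%:E
             + (1 - lambda)%:E * CEF_S A B fA fB]].

(* Here too, membership in P is only required for n >= 1.                     *)
Definition inf_seq (R : realType) (X : metricType R) (A B : set X) (C : Type)
    (P : set (A * B * C * C)) (f : C -> R) (a : A) (y : B) (v : C)
    (c : nat -> C) : Prop :=
  (f (c n))%:E @[n --> \oo] --> inf_val f /\
  forall n, (0 < n)%N -> P (a, y, c n, v).

(* Main.v *)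
Require Import Defs.
From HB Require Import structures.
From mathcomp Require Import all_boot all_order all_algebra.
From mathcomp Require Import all_classical all_reals all_analysis.
From mathcomp Require Import lra.

Set Implicit Arguments.
Unset Strict Implicit.
Unset Printing Implicit Defensive.

Import Order.TTheory GRing.Theory Num.Theory.

Local Open Scope classical_set_scope.
Local Open Scope ring_scope.
Local Open Scope ereal_scope.

(** Write [d], [iA], [iB] for the distance of [A] and [B] and the two infima.
    On [P] the nonnegative quantity
      excess = (mdist x y - d) + (fA u - iA) + (fB v - iB)
    is contracted by the factor [lambda] when both orbits advance by one step:
    this is the inequality of [CEF] after subtracting the constant term
    ([CEF_excess]).  Along two orbits it is thus a double sequence [g n m] that
    shrinks geometrically along diagonals, and it tends to 0 jointly in [n] and
    [m] as soon as it is bounded on the first row and the first column.  There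
    the triangle inequality compares [g n 0] with [g n 1] up to a constant, and
    [g (n + 1) 1 <= lambda * g n 0], so the first column satisfies an affine
    recursion of slope [lambda < 1] and is bounded ([diagonal_contraction]).

    Call a pair of sequences asymptotic ([asymptotic]) when its points of index
    at least 1 lie in [P] and its excess tends to 0 jointly.  Such a pair
    fulfils the premises of property [CD], so its [A]-side converges.  If two
    [A]-sides are asymptotic to the same [B]-side, so is the sequence obtained
    by interlacing them, hence they have the same limit
    ([asymptotic_common_limit]).  All uniqueness claims come from this:
    - (1) is [orbits_asymptotic] together with [CD], and (2) compares the two
      orbits of [TA] with one and the same orbit of [TB];
    - for (3) and (4), let [c] be an infimum sequence at a point [b].  One step
      of the contraction shows that the points [TA b (c n)] are asymptotic to
      the orbit [y] of [TB], provided that [mdist b (y m)] tends to [d]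
      ([perturbed_asymptotic]).  They then have the limit of the orbit of [TA].
      The proviso holds by (1) when [b] is that limit; it also holds when
      [TA b (c n)] tends to [b], because letting [n] grow in the contraction
      makes the excess of [b] against [y m] decay geometrically
      ([fixed_excess]). *)

(** * Real sequences *)

(** Distances, suprema of distances and values of [fA] and [fB] all stay above
    the infimum that they tend to, so an upper bound suffices.  The first terms
    may be infinite, as the suprema in [CD] can be. *)
Lemma cvg_from_above (R : realType) (a : nat -> \bar R) (l : R) :
  (forall n, l%:E <= a n) ->
  (forall e : R, (0 < e)%R -> \forall n \near \oo, a n <= (l + e)%:E) ->
  a n @[n --> \oo] --> l%:E.
Proof.
move=> la ale; have fin e n : a n <= (l + e)%:E -> a n \is a fin_num.
  move=> an; rewrite fin_numElt (lt_le_trans _ (la n)) ?ltNyr//=.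
  exact: le_lt_trans an (ltry _).
apply/fine_cvgP; split.
  by near=> n; apply: (fin 1%R); near: n; exact: ale.
apply/cvgrPdist_le => e e0; near=> n.
have an : a n <= (l + e)%:E by near: n; exact: ale.
have an_fin := fin _ _ an.
move: an (la n); rewrite -(fineK an_fin) !lee_fin /= => an ln.
by rewrite ler_norml; apply/andP; split; lra.
Unshelve. all: by end_near. Qed.

Lemma cvg_EFin_near_le (R : realType) (a : nat -> R) (l : \bar R) (e : R) :
  l \is a fin_num -> (0 < e)%R -> (a n)%:E @[n --> \oo] --> l ->
  \forall n \near \oo, (a n - fine l <= e)%R.
Proof.
move=> lfin e0; rewrite -{1}(fineK lfin) => /fine_cvgP[_ /cvgrPdist_le].
move=> /(_ e e0); apply: filterS => n /=.
by rewrite ler_norml => /andP[]; lra.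
Qed.

Lemma affine_rec_bounded (R : realFieldType) (lambda K : R) (a : nat -> R) :
  (0 <= lambda)%R -> (lambda < 1)%R ->
  (forall n, (a n.+1 <= lambda * a n + K)%R) ->
  exists M, forall n, (a n <= M)%R.
Proof.
move=> l0 l1 aK.
(* The fixed point of the affine map: above it, the map decreases. *)
pose M := Num.max (a 0%N) (K / (1 - lambda))%R.
have KM : (K <= M * (1 - lambda))%R.
  by rewrite -ler_pdivrMr ?subr_gt0// /M le_max lexx orbT.
exists M; elim=> [|n IHn]; first by rewrite /M le_max lexx.
apply: le_trans (aK n) _.
have := ler_wpM2l l0 IHn; lra.
Qed.

Lemma pow_mul_near_le (R : realType) (lambda M e : R) :
  (0 <= lambda)%R -> (lambda < 1)%R -> (0 < e)%R ->
  \forall n \near \oo, (lambda ^+ n * M <= e)%R.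
Proof.
move=> l0 l1 e0.
have l1' : (`|lambda| < 1)%R by rewrite ger0_norm.
move: (@cvg_geometric R M lambda l1') => /cvgrPdist_le /(_ e e0).
apply: filterS => n; rewrite /= /geometric /= sub0r normrN mulrC => h.
exact: le_trans (ler_norm _) h.
Qed.

(** The diagonal contraction alone says nothing about the entries far out on
    the border of the quadrant.  The comparison of each border entry with its
    inner neighbour turns it into an affine recursion along the border, so the
    border, and then all of [g], is bounded. *)
Lemma diagonal_contraction (R : realType) (lambda K : R) (g : nat -> nat -> R) :
  (0 <= lambda)%R -> (lambda < 1)%R ->
  (forall n m, (0 <= g n m)%R) ->
  (forall n m, (g n.+1 m.+1 <= lambda * g n m)%R) ->
  (forall n, (g n 0%N <= g n 1%N + K)%R) ->
  (forall m, (g 0%N m <= g 1%N m + K)%R) ->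
  forall e : R, (0 < e)%R -> \forall N \near \oo,
    forall n m, (N <= n)%N -> (N <= m)%N -> (g n m <= e)%R.
Proof.
move=> l0 l1 g0 gl gcol grow e e0.
have [M1 colM] : exists M, forall n, (g n 0%N <= M)%R.
  apply: (affine_rec_bounded (K := K) l0 l1) => n.
  by apply: le_trans (gcol _) _; rewrite lerD2r.
have [M2 rowM] : exists M, forall m, (g 0%N m <= M)%R.
  apply: (affine_rec_bounded (K := K) l0 l1) => m.
  by apply: le_trans (grow _) _; rewrite lerD2r.
pose M := Num.max M1 M2.
have gM n m : (g n m <= M)%R.
  elim: n m => [|n IHn] [|m].
  - by rewrite le_max colM.
  - by rewrite le_max rowM orbT.
  - by rewrite le_max colM.
  - apply: le_trans (gl n m) _; apply: le_trans (ler_wpM2l l0 (IHn m)) _.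
    by rewrite ler_piMl ?(le_trans (g0 n m))// ltW.
have gpow N n m : (N <= n)%N -> (N <= m)%N -> (g n m <= lambda ^+ N * M)%R.
  elim: N n m => [|N IHN] [|n] [|m]; rewrite ?expr0 ?mul1r//.
  rewrite !ltnS => Nn Nm; apply: le_trans (gl n m) _.
  by rewrite exprS -mulrA ler_wpM2l// IHN.
apply: filterS (pow_mul_near_le M l0 l1 e0) => N NM n m Nn Nm.
exact: le_trans (gpow _ _ _ Nn Nm) NM.
Qed.

(** * Limits of interlaced sequences *)

(** The terms of [x] are taken from index 1 on: in property [CD] the values at
    index 0 are unconstrained, so [x 0] must not occur at a positive index. *)
Definition interlace (T : Type) (x z : nat -> T) (n : nat) : T :=
  if odd n then x n./2.+1 else z n./2.

Lemma interlaceS2 (T : Type) (x z : nat -> T) n :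
  interlace x z n.*2.+1 = x n.+1.
Proof. by rewrite /interlace /= odd_double /= uphalf_double. Qed.

Lemma interlace2 (T : Type) (x z : nat -> T) n : interlace x z n.*2 = z n.
Proof. by rewrite /interlace odd_double doubleK. Qed.

Lemma cvg_interlace (X : topologicalType) (x z : nat -> X) (a : X) :
  interlace x z n @[n --> \oo] --> a ->
  x n @[n --> \oo] --> a /\ z n @[n --> \oo] --> a.
Proof.
move=> wa; split=> P /wa [N _ NP].
  exists N.+1 => // -[//|n] /= Nn; rewrite -(interlaceS2 x z).
  by apply: NP; rewrite /= leqW// -addnn (leq_trans (Nn : (N <= n)%N))// leq_addr.
exists N => // n /= Nn; rewrite -(interlace2 x z).
by apply: NP; rewrite /= (leq_trans Nn)// -addnn leq_addr.
Qed.

(** * Excess over the infimum *)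

Lemma set_dist_fin_num (R : realType) (X : metricType R) (A B : set X)
    (a : A) (b : B) : set_dist A B \is a fin_num.
Proof.
rewrite ge0_fin_numE; last first.
  by apply: le_ereal_inf_tmp => _ [x _ [y _ <-]]; rewrite lee_fin mdist_ge0.
apply: le_lt_trans (ltry (mdist (val a) (val b))).
apply: ereal_inf_lbound.
by exists (val a); [exact/set_mem/valP|exists (val b); [exact/set_mem/valP|]].
Qed.

Lemma fine_set_dist_le (R : realType) (X : metricType R) (A B : set X)
    (a : A) (b : B) : (fine (set_dist A B) <= mdist (val a) (val b))%R.
Proof.
rewrite -lee_fin (fineK (set_dist_fin_num a b)).
apply: ereal_inf_lbound.
by exists (val a); [exact/set_mem/valP|exists (val b); [exact/set_mem/valP|]].
Qed.

Lemma fine_inf_val_le (R : realType) (C : Type) (f : C -> R) (c : C) :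
  inf_val f \is a fin_num -> (fine (inf_val f) <= f c)%R.
Proof.
by move=> ffin; rewrite -lee_fin fineK//; apply: ereal_inf_lbound; exists c.
Qed.

Lemma iterated_exists (A C : Type) (T : A -> C -> A) (H : A -> C -> C) x0 u0 :
  exists x u, iterated T H x0 u0 x u.
Proof.
pose F p := (T p.1 p.2, H p.1 p.2).
by exists (fun n => (iter n F (x0, u0)).1), (fun n => (iter n F (x0, u0)).2).
Qed.

Section Asymptotics.
Context (R : realType) (X : metricType R) (A B : set X) (C : Type).
Context (P : set (A * B * C * C)) (fA fB : C -> R).
Context (fAfin : inf_val fA \is a fin_num) (fBfin : inf_val fB \is a fin_num).

Definition excess (x : A) (y : B) (u v : C) : R :=
  ((mdist (val x) (val y) - fine (set_dist A B)) +
   (fA u - fine (inf_val fA)) + (fB v - fine (inf_val fB)))%R.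

(** Convergence to 0 is required jointly in [n] and [m], because [CD] bounds the
    distances of all pairs of late points, not only those of equal index. *)
Definition asymptotic (x : nat -> A) (y : nat -> B) (u v : nat -> C) : Prop :=
  (forall n m, (0 < n)%N -> (0 < m)%N -> P (x n, y m, u n, v m)) /\
  forall e : R, (0 < e)%R -> \forall N \near \oo,
    forall n m, (N <= n)%N -> (N <= m)%N ->
      (excess (x n) (y m) (u n) (v m) <= e)%R.

Lemma excess_ge0 x y u v : (0 <= excess x y u v)%R.
Proof.
have := fine_set_dist_le x y.
have := fine_inf_val_le u fAfin; have := fine_inf_val_le v fBfin.
rewrite /excess; lra.
Qed.

Lemma mdist_le_excess x y u v :
  (mdist (val x) (val y) <= fine (set_dist A B) + excess x y u v)%R.
Proof.
have := fine_inf_val_le u fAfin; have := fine_inf_val_le v fBfin.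
rewrite /excess; lra.
Qed.

Lemma fA_le_excess x y u v : (fA u <= fine (inf_val fA) + excess x y u v)%R.
Proof.
have := fine_set_dist_le x y; have := fine_inf_val_le v fBfin.
rewrite /excess; lra.
Qed.

Lemma fB_le_excess x y u v : (fB v <= fine (inf_val fB) + excess x y u v)%R.
Proof.
have := fine_set_dist_le x y; have := fine_inf_val_le u fAfin.
rewrite /excess; lra.
Qed.

Lemma asymptotic_fA x y u v : asymptotic x y u v ->
  (fA (u n))%:E @[n --> \oo] --> inf_val fA.
Proof.
move=> [_ xe]; rewrite -(fineK fAfin); apply: cvg_from_above => [n|e /xe].
  by rewrite lee_fin fine_inf_val_le.
apply: filterS => N /(_ N N (leqnn _) (leqnn _)) ge; rewrite lee_fin.
by apply: le_trans (fA_le_excess (x N) (y N) (u N) (v N)) _; rewrite lerD2l.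
Qed.

Lemma asymptotic_fB x y u v : asymptotic x y u v ->
  (fB (v n))%:E @[n --> \oo] --> inf_val fB.
Proof.
move=> [_ xe]; rewrite -(fineK fBfin); apply: cvg_from_above => [n|e /xe].
  by rewrite lee_fin fine_inf_val_le.
apply: filterS => N /(_ N N (leqnn _) (leqnn _)) ge; rewrite lee_fin.
by apply: le_trans (fB_le_excess (x N) (y N) (u N) (v N)) _; rewrite lerD2l.
Qed.

Lemma asymptotic_sup_mdist x y u v : asymptotic x y u v ->
  ereal_sup [set (mdist (val (x n)) (val (y m)))%:E
              | n in [set n | (k <= n)%N] & m in [set m | (k <= m)%N]]
    @[k --> \oo] --> set_dist A B.
Proof.
move=> [_ xe]; rewrite -(fineK (set_dist_fin_num (x 0%N) (y 0%N))).
apply: cvg_from_above => [k|e /xe].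
  apply: (@le_trans _ _ (mdist (val (x k)) (val (y k)))%:E).
    by rewrite lee_fin fine_set_dist_le.
  by apply: ereal_sup_ubound; exists k => //=; exists k => /=.
apply: filterS => k ge; apply: ge_ereal_sup => _ [n kn [m km <-]].
rewrite lee_fin; apply: le_trans (mdist_le_excess _ _ (u n) (v m)) _.
by rewrite lerD2l ge.
Qed.

Lemma asymptotic_mdist_lim x y u v (a : A) : asymptotic x y u v ->
  val (x n) @[n --> \oo] --> val a ->
  (mdist (val (y n)) (val a))%:E @[n --> \oo] --> set_dist A B.
Proof.
move=> [_ xe] xa; rewrite -(fineK (set_dist_fin_num a (y 0%N))).
apply: cvg_from_above => [n|e e0].
  by rewrite lee_fin metric_sym fine_set_dist_le.
have e2 : (0 < e / 2)%R by rewrite divr_gt0.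
have xa2 : \forall n \near \oo, (mdist (val a) (val (x n)) <= e / 2)%R.
  exact: metricType_numDomainType.cvgr_dist_le xa _ e2.
near=> n; have xan : (mdist (val a) (val (x n)) <= e / 2)%R.
  by near: n; exact: xa2.
have ge : (excess (x n) (y n) (u n) (v n) <= e / 2)%R.
  near: n; apply: filterS (xe _ e2) => N; exact.
rewrite lee_fin.
have := mdist_le_excess (x n) (y n) (u n) (v n).
have := metric_triangle (val a) (val (x n)) (val (y n)).
rewrite (metric_sym (val a) (val (y n))).
lra.
Unshelve. all: by end_near. Qed.

Lemma asymptotic_interlace x z y u t v :
  asymptotic x y u v -> asymptotic z y t v ->
  asymptotic (interlace x z) y (interlace u t) v.
Proof.
move=> [xP xe] [zP ze]; split.
  move=> n m n0 m0; rewrite /interlace; case: ifPn => nodd; first exact: xP.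
  by apply: zP => //; case: n n0 nodd => [|[|n]].
move=> e e0; have := filterI (xe _ e0) (ze _ e0) => -[N _ hN].
exists N.*2 => // k /= Nk n m kn km.
have [hx hz] := hN N (leqnn N).
have Nm : (N <= m)%N.
  by apply: leq_trans km; apply: leq_trans Nk; rewrite -addnn leq_addr.
have Nn : (N <= n./2)%N by rewrite -(doubleK N) half_leq// (leq_trans Nk).
by rewrite /interlace; case: ifP => _; [apply: hx => //; exact: leqW|exact: hz].
Qed.

(** [CD] applied to the interlaced sequence forces both limits to agree; with
    [z = x] it just gives the convergence of [x]. *)
Lemma asymptotic_common_limit x z y u t v : CD P fA fB ->
  asymptotic x y u v -> asymptotic z y t v ->
  exists a : A, val (x n) @[n --> \oo] --> val a /\
                val (z n) @[n --> \oo] --> val a.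
Proof.
move=> hCD hx hz; have hw := asymptotic_interlace hx hz.
have [|a wa] := hCD _ _ (asymptotic_sup_mdist hw).
  exists (interlace u t), v; split; first by case: hw.
    exact: asymptotic_fA hw.
  exact: asymptotic_fB hw.
exists a; apply: cvg_interlace.
suff -> : interlace (val \o x) (val \o z) = val \o interlace x z by [].
by apply/funext => n /=; rewrite /interlace; case: ifP.
Qed.

End Asymptotics.

(** * Orbits of contractions with an external factor *)

Section Contraction.
Context (R : realType) (X : metricType R) (A B : set X) (C : Type).
Context (P : set (A * B * C * C)).
Context (TA : A -> C -> A) (TB : B -> C -> B).
Context (HA : A -> C -> C) (HB : B -> C -> C) (fA fB : C -> R).
Context (hCEF : CEF P TA TB HA HB fA fB).

(** The constant [(1 - lambda) * CEF_S A B fA fB] is what turns the affine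
    inequality of [CEF] into a linear one for the excess. *)
Lemma CEF_excess : exists lambda : R, [/\ (0 <= lambda)%R, (lambda < 1)%R &
  forall x y u v, P (x, y, u, v) ->
    (excess fA fB (TA x u) (TB y v) (HA x u) (HB y v)
       <= lambda * excess fA fB x y u v)%R].
Proof.
have [_ fAfin fBfin [l [l0 l1 hl]]] := hCEF.
exists l; split=> // x y u v /hl; rewrite /CEF_S.
rewrite -(fineK (set_dist_fin_num x y)) -(fineK fAfin) -(fineK fBfin).
rewrite -!EFinD lee_fin /excess /=.
lra.
Qed.

Lemma orbits_asymptotic x0 y0 u0 v0 x y u v :
  P (x0, y0, u0, v0) -> iterated TA HA x0 u0 x u -> iterated TB HB y0 v0 y v ->
  asymptotic P fA fB x y u v.
Proof.
move=> P0 xu yv; have [orb fAfin fBfin _] := hCEF.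
have [l [l0 l1 hl]] := CEF_excess.
have Pnm := orb _ _ _ _ _ _ _ _ P0 xu yv; split=> // e e0.
have [_ _ xuS] := xu; have [_ _ yvS] := yv.
(* Indices are shifted by one, as the orbits are only known to be in [P] from index 1 on. *)
pose g n m := excess fA fB (x n.+1) (y m.+1) (u n.+1) (v m.+1).
(* Replacing [y 1] by [y 2], or [x 1] by [x 2], costs at most the displacement
   of the point and of its external factor, for any point on the other side. *)
pose K : R := (mdist (val (x 1%N)) (val (x 2%N)) + `|fA (u 1%N) - fA (u 2%N)| +
  (mdist (val (y 1%N)) (val (y 2%N)) + `|fB (v 1%N) - fB (v 2%N)|))%R.
have [] // := @diagonal_contraction _ l K g l0 l1 _ _ _ _ e e0.
- by move=> n m; exact: excess_ge0.
- move=> n m; have [xS uS] := xuS n.+1; have [yS vS] := yvS m.+1.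
  by rewrite /g xS uS yS vS; apply: hl; exact: Pnm.
- move=> n; rewrite /g /excess /K.
  have := metric_triangle (val (x n.+1)) (val (y 2%N)) (val (y 1%N)).
  rewrite (metric_sym (val (y 2%N))).
  have := mdist_ge0 (val (x 1%N)) (val (x 2%N)).
  have := normr_ge0 (fA (u 1%N) - fA (u 2%N))%R.
  have := ler_norm (fB (v 1%N) - fB (v 2%N))%R.
  lra.
- move=> m; rewrite /g /excess /K.
  have := metric_triangle (val (x 1%N)) (val (x 2%N)) (val (y m.+1)).
  have := mdist_ge0 (val (y 1%N)) (val (y 2%N)).
  have := normr_ge0 (fB (v 1%N) - fB (v 2%N))%R.
  have := ler_norm (fA (u 1%N) - fA (u 2%N))%R.
  lra.
move=> N _ hN; exists N.+1 => // k /= Nk [|n] [|m] kn km.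
- by move: (leq_trans Nk kn).
- by move: (leq_trans Nk kn).
- by move: (leq_trans Nk km).
exact: hN N (leqnn N) n m (leq_trans Nk kn) (leq_trans Nk km).
Qed.

Section Perturbation.
Context (orb0 : orbits_in 0 P TA HA TB HB).
Context (b : A) (y0 : B) (v0 : C) (c : nat -> C).
Context (hc : inf_seq P fA b y0 v0 c).
Context (y : nat -> B) (v : nat -> C) (yv : iterated TB HB y0 v0 y v).

(** The part of the excess of [(b, y m, c n, v m)] independent of [n]. *)
Let excessB m : R := (mdist (val b) (val (y m)) - fine (set_dist A B) +
  (fB (v m) - fine (inf_val fB)))%R.

(** The orbit of [TA] from [(b, c n)] is in [P] with the whole orbit of [TB]:
    its index 0 allows one contraction step from [(b, y m)] for every [m], and
    its index 1 gives the membership in [P]. *)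
Lemma perturbed_excess : exists lambda : R,
  [/\ (0 <= lambda)%R, (lambda < 1)%R & forall n m, (0 < n)%N ->
   P (TA b (c n), y m, HA b (c n), v m) /\
   (excess fA fB (TA b (c n)) (y m.+1) (HA b (c n)) (v m.+1)
     <= lambda * (excessB m + (fA (c n) - fine (inf_val fA))))%R].
Proof.
have [l [l0 l1 hl]] := CEF_excess; exists l; split=> // n m n0.
have Pn : P (b, y0, c n, v0) by apply: hc.2.
have [x [u xu]] := iterated_exists TA HA b (c n).
have [x0 u0 xuS] := xu; have [xS uS] := xuS 0%N.
have Pm := orb0 Pn xu yv; have [_ _ yvS] := yv; have [yS vS] := yvS m.
split; first by have := Pm 1%N m; rewrite xS uS x0 u0; exact.
have Pbm : P (b, y m, c n, v m) by have := Pm 0%N m; rewrite x0 u0; exact.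
rewrite yS vS; apply: le_trans (hl _ _ _ _ Pbm) _.
by apply: ler_wpM2l => //; rewrite /excess /excessB; lra.
Qed.

(** Both terms on the right of [perturbed_excess] vanish, one as [m] grows and
    the other as [n] grows, so the left side tends to 0 jointly. *)
Lemma perturbed_asymptotic :
  (forall e : R, (0 < e)%R -> \forall m \near \oo, (excessB m <= e)%R) ->
  asymptotic P fA fB (TA b \o c) y (HA b \o c) v.
Proof.
move=> be; have [_ fAfin fBfin _] := hCEF.
have [l [l0 l1 hl]] := perturbed_excess.
split=> [n m n0 _|e e0]; first exact: (hl n m n0).1.
have e2 : (0 < e / 2)%R by rewrite divr_gt0.
have [N1 _ hN1] := be _ e2.
have [N2 _ hN2] := cvg_EFin_near_le fAfin e2 hc.1.
exists (maxn N1 N2).+1 => // k /= Nk n [|m] kn km.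
  by move: (leq_trans Nk km).
have [N1m N2n] : (N1 <= m)%N /\ (N2 < n)%N.
  move: (leq_trans Nk km) (leq_trans Nk kn).
  by rewrite ltnS !gtn_max geq_max => /andP[? _] /andP[_ ?].
have n0 : (0 < n)%N by apply: leq_ltn_trans N2n.
apply: le_trans (hl n m n0).2 _.
have := hN1 _ N1m; have /= := hN2 n (ltnW N2n) => ca ba.
have E0 : (0 <= excessB m)%R.
  have := fine_set_dist_le b (y m); have := fine_inf_val_le (v m) fBfin.
  rewrite /excessB; lra.
have F0 := fine_inf_val_le (c n) fAfin.
apply: le_trans (_ : _ <= excessB m + (fA (c n) - fine (inf_val fA)))%R _.
  by apply: ler_piMl; [lra|exact: ltW].
lra.
Qed.

(** The contraction bounds [excessB m.+1], up to the distance of [b] and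
    [TA b (c n)], by [lambda * excessB m] plus a term in [fA (c n)]; both errors
    vanish as [n] grows with [m] fixed.  Keeping the [fB] part inside [excessB]
    is what makes the recursion linear. *)
Lemma fixed_excess :
  val (TA b (c n)) @[n --> \oo] --> val b ->
  forall e : R, (0 < e)%R -> \forall m \near \oo, (excessB m <= e)%R.
Proof.
move=> Tb e e0; have [_ fAfin fBfin _] := hCEF.
have [l [l0 l1 hl]] := perturbed_excess.
have step m : (excessB m.+1 <= l * excessB m)%R.
  apply/ler_addgt0Pr => d d0; have d2 : (0 < d / 2)%R by rewrite divr_gt0.
  have [N1 _ hN1] : \forall n \near \oo,
      (mdist (val b) (val (TA b (c n))) <= d / 2)%R.
    exact: metricType_numDomainType.cvgr_dist_le Tb _ d2.
  have [N2 _ hN2] := cvg_EFin_near_le fAfin d2 hc.1.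
  pose n := (maxn N1 N2).+1.
  have /= D1 := hN1 n (leqW (leq_maxl _ _)).
  have /= D2 := hN2 n (leqW (leq_maxr _ _)).
  have := (hl n m isT).2; rewrite mulrDr.
  have F0 := fine_inf_val_le (c n) fAfin.
  have G0 := fine_inf_val_le (HA b (c n)) fAfin.
  have : (l * (fA (c n) - fine (inf_val fA)) <= d / 2)%R.
    by apply: le_trans D2; apply: ler_piMl; [lra|exact: ltW].
  have := metric_triangle (val b) (val (TA b (c n))) (val (y m.+1)).
  rewrite /excess /excessB; lra.
have pow m : (excessB m <= l ^+ m * excessB 0)%R.
  elim: m => [|m IHm]; first by rewrite expr0 mul1r.
  apply: le_trans (step m) _.
  by rewrite exprS -mulrA; exact: ler_wpM2l.
apply: filterS (pow_mul_near_le (excessB 0) l0 l1 e0) => m.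
exact: le_trans (pow m).
Qed.

End Perturbation.

End Contraction.

Theorem theorem2 (R : realType) (X : metricType R) (A B : set X) (C : Type)
    (P : set (A * B * C * C))
    (TA : A -> C -> A) (TB : B -> C -> B)
    (HA : A -> C -> C) (HB : B -> C -> C) (fA fB : C -> R)
    (hCEF : CEF P TA TB HA HB fA fB) (hCD : CD P fA fB) :
  [/\ (* (1) *)
      forall (x0 : A) (y0 : B) (u0 v0 : C)
          (x : nat -> A) (y : nat -> B) (u v : nat -> C),
        P (x0, y0, u0, v0) ->
        iterated TA HA x0 u0 x u -> iterated TB HB y0 v0 y v ->
        exists alpha : A,
          [/\ val (x n) @[n --> \oo] --> val alpha,
              (mdist (val (y n)) (val alpha))%:E @[n --> \oo]
                --> set_dist A B,
              (fA (u n))%:E @[n --> \oo] --> inf_val fA &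
              (fB (v n))%:E @[n --> \oo] --> inf_val fB],
      (* (2) *)
      forall (x0 z0 : A) (y0 : B) (u0 t0 v0 : C)
          (x z : nat -> A) (u t : nat -> C),
        P (x0, y0, u0, v0) -> P (z0, y0, t0, v0) ->
        iterated TA HA x0 u0 x u -> iterated TA HA z0 t0 z t ->
        exists alpha : A,
          val (x n) @[n --> \oo] --> val alpha /\
          val (z n) @[n --> \oo] --> val alpha,
      (* (3): orbits taken from index 0, see orbits_in *)
      orbits_in 0 P TA HA TB HB ->
      forall (x0 : A) (y0 : B) (u0 v0 : C) (x : nat -> A) (u : nat -> C)
          (alpha : A) (c : nat -> C),
        P (x0, y0, u0, v0) -> iterated TA HA x0 u0 x u ->
        val (x n) @[n --> \oo] --> val alpha ->
        inf_seq P fA alpha y0 v0 c ->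
        val (TA alpha (c n)) @[n --> \oo] --> val alpha &
      (* (4): orbits taken from index 0, see orbits_in *)
      orbits_in 0 P TA HA TB HB ->
      forall (x0 : A) (y0 : B) (u0 v0 : C) (x : nat -> A) (u : nat -> C)
          (alpha : A),
        P (x0, y0, u0, v0) -> iterated TA HA x0 u0 x u ->
        val (x n) @[n --> \oo] --> val alpha ->
        ~ exists beta : A, beta <> alpha /\
            exists c : nat -> C, inf_seq P fA beta y0 v0 c /\
              val (TA beta (c n)) @[n --> \oo] --> val beta].
Proof.
have [_ fAfin fBfin _] := hCEF.
split.
- move=> x0 y0 u0 v0 x y u v P0 xu yv.
  have as_x := orbits_asymptotic hCEF P0 xu yv.
  have [a [xa _]] := asymptotic_common_limit fAfin fBfin hCD as_x as_x.
  exists a; split=> //.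
  + exact: asymptotic_mdist_lim as_x xa.
  + exact: asymptotic_fA as_x.
  + exact: asymptotic_fB as_x.
- move=> x0 z0 y0 u0 t0 v0 x z u t Px Pz xu zt.
  have [y [v yv]] := iterated_exists TB HB y0 v0.
  exact: (asymptotic_common_limit fAfin fBfin hCD
    (orbits_asymptotic hCEF Px xu yv) (orbits_asymptotic hCEF Pz zt yv)).
- move=> orb0 x0 y0 u0 v0 x u a c P0 xu xa hc.
  have [y [v yv]] := iterated_exists TB HB y0 v0.
  have as_x := orbits_asymptotic hCEF P0 xu yv.
  have as_T : asymptotic P fA fB (TA a \o c) y (HA a \o c) v.
    apply: (perturbed_asymptotic hCEF orb0 hc yv) => e e0.
    have e2 : (0 < e / 2)%R by rewrite divr_gt0.
    have ya := asymptotic_mdist_lim fAfin fBfin as_x xa.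
    have vB := asymptotic_fB fAfin fBfin as_x.
    have D := cvg_EFin_near_le (set_dist_fin_num a y0) e2 ya.
    have F := cvg_EFin_near_le fBfin e2 vB.
    apply: filterS2 D F => m; rewrite metric_sym; lra.
  have [a' [xa' Ta']] := asymptotic_common_limit fAfin fBfin hCD as_x as_T.
  by have -> : val a = val a' by exact: (cvg_unique (@metric_hausdorff _ _) xa xa').
- move=> orb0 x0 y0 u0 v0 x u a P0 xu xa [b [ba [c [hc Tb]]]].
  have [y [v yv]] := iterated_exists TB HB y0 v0.
  have as_x := orbits_asymptotic hCEF P0 xu yv.
  have as_T := perturbed_asymptotic hCEF orb0 hc yv
    (fixed_excess hCEF orb0 hc yv Tb).
  have [a' [xa' Ta']] := asymptotic_common_limit fAfin fBfin hCD as_x as_T.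
  apply: ba; apply: val_inj.
  rewrite (cvg_unique (@metric_hausdorff _ _) xa xa').
  exact: (cvg_unique (@metric_hausdorff _ _) Tb Ta').
Qed.
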